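(* Let $E$ be an $m\times n$ random matrix with independent subGaussian entries $E_{ij}$ with subGaussian moment $\Gamma_E$. Let $X$ be a fixed (nonrandom) $m\times p$ matrix of rank $q$ and let $P=X(X'X)^-X'$ be the projection matrix onto the column space of $X$. Then, for each $x>0$, $$\mathbb{P}\left\{d_1^2(PE)\ge 32\,\Gamma_E\big((n+q)\ln(5)+x\big)\right\}\le 2\exp(-x).$$ In particular, $$\mathbb{E}[d_1(PE)]\le 15\sqrt{\Gamma_E}\,\sqrt{n+q}.$$
   Context: A random variable $W$ is called subGaussian with subGaussian moment $\Gamma_W>0$ if $\mathbb{E}[\exp(tW)]\le\exp(\Gamma_Wt^2/2)$ for all $t\in\mathbb{R}$; it then satisfies $\mathbb{P}\{|W|>t\}\le 2\exp\{-t^2/(2\Gamma_W)\}$ for all $t>0$, and $N(0,\sigma^2)$ random variables are subGaussian with moment $\sigma^2$. $d_1(C)$ denotes the largest singular value of a matrix $C$, and $(X'X)^-$ is the Moore–Penrose inverse of $X'X$. *)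

(* Defs.v *)
From HB Require Import structures.
From mathcomp Require Export all_boot all_order all_algebra.
From mathcomp Require Export all_classical all_reals all_analysis.
Set Implicit Arguments.
Unset Strict Implicit.
Unset Printing Implicit Defensive.
Import Order.TTheory GRing.Theory Num.Theory.
Local Open Scope classical_set_scope.
Local Open Scope ring_scope.

(* The four Penrose equations, over a real field. *)
Definition is_mpinv (R : realFieldType) (m n : nat)
    (A : 'M[R]_(m, n)) (B : 'M[R]_(n, m)) : Prop :=
  [/\ A *m B *m A = A, B *m A *m B = B,
      (A *m B)^T = A *m B & (B *m A)^T = B *m A].

(* The default value 0 is irrelevant: [is_mpinv_exists] and [is_mpinv_unique]
   below show that the Penrose equations have exactly one solution. *)
Definition mpinv (R : realType) (m n : nat) (A : 'M[R]_(m, n)) :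
    'M[R]_(n, m) :=
  xget 0 [set B | is_mpinv A B].

Lemma is_mpinv_unique (R : realFieldType) (m n : nat) (A : 'M[R]_(m, n))
    (B C : 'M[R]_(n, m)) : is_mpinv A B -> is_mpinv A C -> B = C.
Proof.
move=> [ABA BAB sAB sBA] [ACA CAC sAC sCA].
have eAB : A *m B = A *m C.
  rewrite -sAB -{1}ACA -[A *m C *m A *m B]mulmxA trmx_mul sAB sAC.
  by rewrite !mulmxA ABA.
have eBA : B *m A = C *m A.
  rewrite -sBA -{1}ACA -[A *m C *m A]mulmxA mulmxA trmx_mul sCA sBA.
  by rewrite mulmxA -(mulmxA C) -(mulmxA C) mulmxA -(mulmxA C) ABA.
by rewrite -BAB -CAC eBA -mulmxA eAB mulmxA.
Qed.

Lemma row_free_gram_unit (R : realFieldType) (r n : nat) (M : 'M[R]_(r, n)) :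
  row_free M -> M *m M^T \in unitmx.
Proof.
move=> fM; rewrite -row_free_unit -kermx_eq0; apply/rowV0P => v.
move/sub_kermxP => vMM0.
have vM0 : v *m M = 0.
  have /matrixP/(_ 0 0) : (v *m M) *m (v *m M)^T = 0.
    by rewrite trmx_mul mulmxA -(mulmxA v) vMM0 mul0mx.
  rewrite !mxE => /eqP.
  rewrite psumr_eq0 => [/allP s0|j _]; last by rewrite [_^T _ _]mxE -expr2 sqr_ge0.
  apply/rowP => j; have := s0 j (mem_index_enum j).
  by rewrite [_^T _ _]mxE -expr2 sqrf_eq0 [RHS]mxE => /eqP.
by apply: (row_free_inj fM); rewrite vM0 mul0mx.
Qed.

Lemma is_mpinv_exists (R : realFieldType) (m n : nat) (A : 'M[R]_(m, n)) :
  exists B, is_mpinv A B.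
Proof.
have CF : A = col_base A *m row_base A by rewrite mulmx_base.
move: (row_base_free A) (col_base_full A) CF.
move: (col_base A) (row_base A) => C F fF fC ->.
have uF := row_free_gram_unit fF.
have : row_free C^T by rewrite /row_free mxrank_tr.
move/row_free_gram_unit; rewrite trmxK => uC.
set G := F *m F^T in uF *; set H := C^T *m C in uC *.
have sG : (invmx G)^T = invmx G by rewrite trmx_inv trmx_mul trmxK.
have sH : (invmx H)^T = invmx H by rewrite trmx_inv trmx_mul trmxK.
set B := F^T *m invmx G *m invmx H *m C^T.
have AB : C *m F *m B = C *m invmx H *m C^T.
  rewrite /B !mulmxA -(mulmxA C F) -/G -(mulmxA C G) mulmxV //.
  by rewrite mulmx1.
have BA : B *m (C *m F) = F^T *m invmx G *m F.
  rewrite /B !mulmxA -(mulmxA _ C^T C) -/H -(mulmxA _ (invmx H) H) mulVmx //.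
  by rewrite mulmx1.
exists B; split.
- rewrite AB !mulmxA -(mulmxA _ C^T C) -/H -(mulmxA _ (invmx H) H) mulVmx //.
  by rewrite mulmx1.
- rewrite BA /B !mulmxA -(mulmxA _ F F^T) -/G -(mulmxA _ (invmx G) G) mulVmx //.
  by rewrite mulmx1.
- by rewrite AB !trmx_mul trmxK sH mulmxA.
- by rewrite BA !trmx_mul trmxK sG mulmxA.
Qed.

Lemma is_mpinv_mpinv (R : realType) (m n : nat) (A : 'M[R]_(m, n)) :
  is_mpinv A (mpinv A).
Proof. exact: (@xgetPex _ 0 [set B | is_mpinv A B] (is_mpinv_exists A)). Qed.

Lemma mpinv_unique (R : realType) (m n : nat) (A : 'M[R]_(m, n))
    (B : 'M[R]_(n, m)) : is_mpinv A B -> B = mpinv A.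
Proof. by move=> AB; apply: is_mpinv_unique AB (is_mpinv_mpinv A). Qed.

Definition col_proj (R : realType) (m p : nat) (X : 'M[R]_(m, p)) : 'M[R]_m :=
  X *m mpinv (X^T *m X) *m X^T.

(* If m < n this also counts the n - m trivial zero singular values, which
   does not affect the largest one. *)
Definition singular_value (R : realType) (m n : nat) (C : 'M[R]_(m, n)) :
    set R :=
  [set s | 0 <= s /\ eigenvalue (C^T *m C) (s ^+ 2)].

(* The supremum of a finite set that is nonempty for n > 0, hence a maximum;
   it is 0 for a matrix without rows or columns. *)
Definition d1 (R : realType) (m n : nat) (C : 'M[R]_(m, n)) : R :=
  sup (singular_value C).

Definition subGaussian d (T : measurableType d) (R : realType)
    (P : probability T R) (W : {RV P >-> R}) (Gamma : R) : Prop :=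
  0 < Gamma /\
  forall t : R, ('M_P W t <= (expR (Gamma * t ^+ 2 / 2))%:E)%E.

(* Mutual independence of a finite family of real random variables. *)
Definition independent_RVs d (T : measurableType d) (R : realType)
    (P : probability T R) (I : finType) (W : I -> {RV P >-> R}) : Prop :=
  forall (J : {set I}) (A : I -> set R),
    (forall i, i \in J -> measurable (A i)) ->
    P (\bigcap_(i in [set` J]) (W i @^-1` A i)) =
    (\prod_(i in J) P (W i @^-1` A i))%E.

Definition random_mx d (T : measurableType d) (R : realType)
    (P : probability T R) (m n : nat) (E : 'I_m * 'I_n -> {RV P >-> R})
    (w : T) : 'M[R]_(m, n) :=
  \matrix_(i, j) E (i, j) w.

(* Main.v *)
Require Import Defs.
From mathcomp Require Import perm measurable_realfun ring lra.
Set Implicit Arguments.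
Unset Strict Implicit.
Unset Printing Implicit Defensive.
Import Order.TTheory GRing.Theory Num.Theory.
Import numFieldNormedType.Exports.
Local Open Scope classical_set_scope.
Local Open Scope ring_scope.

(* Write the projection as [U *m U^T] with [U] having [k <= q] orthonormal
   columns. Then the singular values of [P E] are values [u^T A v] of the
   bilinear form of [A = U^T E] at points of the unit balls of dimensions [k]
   and [n]. Rounding the coordinates towards 0 to multiples of
   [1 / (4 sqrt n)] moves a point of the unit ball by at most 1/4, so
   [d1 (P E)] is at most twice the maximum of the form over pairs of lattice
   points of the balls, of which there are at most [64 ^ (n + k)]; this crude
   count replaces the volumetric bound on nets since [64 <= 5 ^ 4]. At each
   pair the form is subGaussian with moment [GammaE], whence
   [E exp (l d1 / 2) <= 64 ^ (n + q) exp (GammaE l^2 / 2)] for all [l > 0].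
   Markov's inequality gives the tail bound, and the tangent line of the
   exponential gives the expectation (even with 7 instead of 15).
   That [d1] is measurable is seen through the roots of the characteristic
   polynomial. *)

(** * Lattice nets and bilinear forms *)

Definition sqnorm (R : realType) (n : nat) (u : 'cV[R]_n) : R := \sum_i u i 0 ^+ 2.

Definition bform (R : realType) (k n : nat) (A : 'M[R]_(k, n)) (u : 'cV[R]_k)
    (v : 'cV[R]_n) : R := \sum_i \sum_j u i 0 * A i j * v j 0.

(** Points are coded by a finite type so that they can be summed over. A coordinate of absolute
    value at most 1 takes at most [4 * sqrt n <= 4 * n] steps, so the box covers the unit ball. A
    zero coordinate has two codes, which is harmless for an upper bound on the count. *)
Definition lattice_pt (R : realType) (n : nat)
    (z : {ffun 'I_n -> bool * 'I_(4 * n).+1}) : 'cV[R]_n :=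
  \col_i ((-1) ^+ (z i).1 * ((z i).2%:R / (4 * Num.sqrt n%:R))).

Lemma sqnorm_mulmx (R : realType) n (u : 'cV[R]_n) :
  sqnorm u = (u^T *m u) 0 0.
Proof. by rewrite mxE; apply: eq_bigr => i _; rewrite mxE expr2. Qed.

Lemma sqnormZ (R : realType) n (a : R) (u : 'cV[R]_n) :
  sqnorm (a *: u) = a ^+ 2 * sqnorm u.
Proof. by rewrite /sqnorm mulr_sumr; apply: eq_bigr => i _; rewrite mxE exprMn. Qed.

Lemma sqnorm_ge0 (R : realType) n (u : 'cV[R]_n) : 0 <= sqnorm u.
Proof. by apply: sumr_ge0 => i _; exact: sqr_ge0. Qed.

Lemma sqnorm_eq0 (R : realType) n (u : 'cV[R]_n) : sqnorm u = 0 -> u = 0.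
Proof.
move=> /eqP; rewrite psumr_eq0 => [/allP u0|i _]; last exact: sqr_ge0.
apply/colP => i; rewrite mxE; apply/eqP.
by rewrite -sqrf_eq0; exact: u0 (mem_index_enum i).
Qed.

Lemma sqnorm_coord_le1 (R : realType) n (u : 'cV[R]_n) i :
  sqnorm u <= 1 -> `|u i 0| <= 1.
Proof.
move=> u1; rewrite -(@ler_pXn2r _ 2) ?nnegrE// expr1n real_normK ?num_real//.
apply: le_trans u1; rewrite /sqnorm (bigD1 i)//= lerDl.
by apply: sumr_ge0 => j _; exact: sqr_ge0.
Qed.

Lemma bform_mulmx (R : realType) k n (A : 'M[R]_(k, n)) u v :
  bform A u v = (u^T *m A *m v) 0 0.
Proof.
rewrite -mulmxA mxE; apply: eq_bigr => i _; rewrite !mxE mulr_sumr.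
by apply: eq_bigr => j _; rewrite mulrA.
Qed.

(** Rounding towards 0 shrinks every coordinate, so the point stays in the ball; each of the [n]
    coordinates moves by at most [1 / (4 sqrt n)], and the squares add up to at most [1 / 16]. *)
Lemma lattice_pt_approx (R : realType) n (v : 'cV[R]_n) : sqnorm v <= 1 ->
  exists z, sqnorm (lattice_pt R z) <= 1 /\ sqnorm (v - lattice_pt R z) <= 16^-1.
Proof.
case: n v => [|n] v v1.
  exists [ffun=> (true, ord0)].
  by rewrite /sqnorm !big_ord0 ler01 invr_ge0 ler0n.
set c : R := 4 * Num.sqrt n.+1%:R.
have c0 : 0 < c by rewrite mulr_gt0// sqrtr_gt0 ltr0n.
have cN : c <= (4 * n.+1)%:R.
  rewrite natrM ler_pM2l// -{2}[n.+1%:R]sqr_sqrtr ?ler0n// expr2.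
  by rewrite ler_peMl ?sqrtr_ge0// -[leLHS]sqrtr1 ler_wsqrtr// ler1n.
pose t i := Num.truncn (`|v i 0| * c).
have tP i : (t i)%:R <= `|v i 0| * c < (t i).+1%:R.
  by apply: truncn_itv; rewrite mulr_ge0// ltW.
have tn i : (t i < (4 * n.+1).+1)%N.
  rewrite ltnS -(@ler_nat R); apply: le_trans cN.
  have /andP[/le_trans le_t _] := tP i; apply: le_t.
  by rewrite ler_piMl ?(ltW c0)//; exact: sqnorm_coord_le1.
pose z := [ffun i => (v i 0 < 0, Ordinal (tn i))].
have zE i : lattice_pt R z i 0 = (-1) ^+ (v i 0 < 0)%R * ((t i)%:R / c).
  by rewrite mxE ffunE.
exists z; split.
  apply: le_trans v1; apply: ler_sum => i _; rewrite zE exprMn sqrr_sign mul1r.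
  rewrite -(real_normK (num_real (v i 0))) ler_pXn2r ?nnegrE//.
    by rewrite ler_pdivrMr//; case/andP: (tP i).
  by rewrite divr_ge0 ?ler0n// ltW.
apply: (@le_trans _ _ (\sum_(i < n.+1) (c ^- 2))).
  apply: ler_sum => i _; rewrite mxE [(- lattice_pt R z) _ _]mxE zE.
  (* Both points carry the same sign, so only the difference of absolute values remains. *)
  rewrite {1}[v i 0]realEsign ?num_real// -mulrBr exprMn sqrr_sign mul1r.
  have /andP[t1 t2] := tP i; rewrite -exprVn.
  rewrite ler_pXn2r ?nnegrE ?invr_ge0 ?(ltW c0)//.
    rewrite lerBlDl -[X in _ <= _ + X]mul1r -mulrDl -natr1 in t2 *.
    by rewrite ler_pdivlMr// ltW.
  by rewrite subr_ge0 ler_pdivrMr.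
rewrite sumr_const card_ord /c exprMn sqr_sqrtr ?ler0n// -[leLHS]mulr_natr.
rewrite invfM mulrAC -mulrA divff ?pnatr_eq0// mulr1.
by rewrite -natrX.
Qed.

Lemma sum_exp2V (R : realType) N : \sum_(k < N) (2 ^- k : R) = 2 - 2 * 2 ^- N.
Proof.
elim: N => [|N IH]; first by rewrite big_ord0 expr0 invr1 mulr1 subrr.
by rewrite big_ord_recr/= IH exprS invfM; lra.
Qed.

(* Each admissible point has [sum_i k_i <= 4 n] by AM-GM, so the weight
   [prod_i 2 ^ (4 - k_i)] is at least 1 on it, while the weights of all points
   of the box sum up to at most [64 ^ n]. *)
Lemma card_lattice_ball (R : realType) n :
  \sum_(z : {ffun 'I_n -> bool * 'I_(4 * n).+1} | sqnorm (lattice_pt R z) <= 1) 1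
  <= 64 ^+ n :> R.
Proof.
case: n => [|n].
  rewrite expr0 (@le_trans _ _ (\sum_(z : {ffun 'I_0 -> bool * 'I_(4 * 0).+1}) 1))//.
    by rewrite [leRHS](bigID (fun z => sqnorm (lattice_pt R z) <= 1))/= lerDl sumr_ge0.
  by rewrite sumr_const card_ffun card_ord expn0.
pose wt (x : bool * 'I_(4 * n.+1).+1) : R := 16 * 2 ^- x.2.
have wt0 x : 0 <= wt x by rewrite mulr_ge0// invr_ge0 exprn_ge0.
apply: (@le_trans _ _ (\sum_(z : {ffun 'I_n.+1 -> _}) \prod_i wt (z i))).
  rewrite [leRHS](bigID (fun z => sqnorm (lattice_pt R z) <= 1))/=.
  apply: ler_wpDr; first by apply: sumr_ge0 => z _; exact: prodr_ge0.
  apply: ler_sum => z z1.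
  have kle : (\sum_i (z i).2 <= 4 * n.+1)%N.
    have : \sum_(i < n.+1) ((z i).2%:R ^+ 2 : R) <= 16 * n.+1%:R.
      move: z1; rewrite /sqnorm.
      under eq_bigr => i _.
        rewrite mxE exprMn sqrr_sign mul1r expr_div_n exprMn sqr_sqrtr ?ler0n//.
        over.
      have c0 : 0 < 4 ^+ 2 * n.+1%:R :> R by rewrite mulr_gt0// exprn_gt0.
      rewrite -mulr_suml ler_pdivrMr// mul1r.
      by rewrite (_ : 4 ^+ 2 = 16 :> R)// -natrX.
    move=> k2; rewrite -(@ler_nat R) natr_sum natrM.
    suff : 8 * \sum_i ((z i).2%:R : R) <= 16 * n.+1%:R + 16 * n.+1%:R by lra.
    apply: (@le_trans _ _ (\sum_(i < n.+1) ((z i).2%:R ^+ 2 + 16))).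
      rewrite mulr_sumr; apply: ler_sum => i _.
      by have := sqr_ge0 ((z i).2%:R - 4 : R); rewrite sqrrB; lra.
    by rewrite big_split/= lerD// sumr_const card_ord -[leLHS]mulr_natr.
  rewrite /wt big_split/= prodr_const card_ord prodfV prodrXr ler_pdivlMr ?exprn_gt0//.
  rewrite mul1r (_ : 16 = 2 ^+ 4); last by rewrite -natrX.
  by rewrite -exprM ler_eXn2l// ltr1n.
(* The sum of product weights factors over the coordinates; each factor is two signs times [16]
   times a geometric sum below 2, hence at most [64]. *)
rewrite -(bigA_distr_bigA (fun _ x => wt x))/= prodr_const card_ord.
rewrite lerXn2r ?nnegrE ?ler0n//; first by apply: sumr_ge0 => x _.
rewrite -(pair_bigA _ (fun (b : bool) (k : 'I_(4 * n.+1).+1) => 16 * 2 ^- k : R))/=.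
rewrite sumr_const card_bool -mulr_sumr sum_exp2V.
have : 0 <= 2 ^- (4 * n.+1).+1 :> R by rewrite invr_ge0 exprn_ge0.
by rewrite -mulr_natr; lra.
Qed.

(** A crude bound, which serves only to make suprema finite. *)
Lemma bform_le_norm (R : realType) k n (A : 'M[R]_(k, n)) u v :
  sqnorm u <= 1 -> sqnorm v <= 1 -> bform A u v <= \sum_i \sum_j `|A i j|.
Proof.
move=> u1 v1; apply: ler_sum => i _; apply: ler_sum => j _.
rewrite (le_trans (ler_norm _))// !normrM mulrAC -[leRHS]mul1r ler_wpM2r//.
by rewrite mulr_ile1//; exact: sqnorm_coord_le1.
Qed.

(** Let [S] be the supremum of the form over the balls. Replacing [u] and then [v] by nearby lattice
    points costs at most [S / 4] each, because four times the rounding error is again in the ball.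
    Thus [S <= M + S / 2], and finiteness of [S] gives [S <= 2 * M]. *)
Lemma bform_le (R : realType) k n (A : 'M[R]_(k, n)) (M : R) :
  (forall y z, sqnorm (lattice_pt R y) <= 1 -> sqnorm (lattice_pt R z) <= 1 ->
    bform A (lattice_pt R y) (lattice_pt R z) <= M) ->
  forall u v, sqnorm u <= 1 -> sqnorm v <= 1 -> bform A u v <= 2 * M.
Proof.
move=> HM.
pose B := [set r | exists u v, [/\ sqnorm u <= 1, sqnorm v <= 1 & r = bform A u v]].
have ubB : has_ubound B.
  exists (\sum_i \sum_j `|A i j|) => _ [u [v [u1 v1 ->]]].
  exact: bform_le_norm.
have leS u v : sqnorm u <= 1 -> sqnorm v <= 1 -> bform A u v <= sup B.
  by move=> u1 v1; apply: ub_le_sup => //; exists u, v.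
have n4 m (u : 'cV[R]_m) : sqnorm u <= 16^-1 -> sqnorm (4 *: u) <= 1.
  by move=> ?; rewrite sqnormZ -natrX -ler_pdivlMl ?ltr0n// mulr1.
have SM u v : sqnorm u <= 1 -> sqnorm v <= 1 -> bform A u v <= M + sup B / 2.
  move=> u1 v1.
  have [y [y1 uy]] := lattice_pt_approx u1.
  have [z [z1 vz]] := lattice_pt_approx v1.
  set a := lattice_pt R y in y1 uy; set b := lattice_pt R z in z1 vz.
  have -> : bform A u v = bform A a b + bform A (4 *: (u - a)) v / 4
      + bform A a (4 *: (v - b)) / 4.
    have ZE (C : 'M[R]_1) : (4 *: C) 0 0 = 4 * C 0 0 by rewrite mxE.
    have BE (C D : 'M[R]_1) : (C - D) 0 0 = C 0 0 - D 0 0 by rewrite !mxE.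
    rewrite !bform_mulmx linearZ/= -!scalemxAl -!scalemxAr !ZE.
    by rewrite linearB/= !mulmxBl mulmxBr !BE; lra.
  have := leS _ _ (n4 _ _ uy) v1; have := leS _ _ y1 (n4 _ _ vz).
  by have := HM _ _ y1 z1; rewrite -/a -/b; lra.
have S2 : sup B <= M + sup B / 2.
  apply: ge_sup => [|_ [u [v [u1 v1 ->]]]]; last exact: SM.
  exists (bform A 0 0), 0, 0.
  by split => //; rewrite /sqnorm big1// => i _; rewrite mxE expr0n.
by move=> u v u1 v1; have := leS _ _ u1 v1; lra.
Qed.

(** * Singular values of projected matrices *)

(** Transposition permutes the Penrose equations of a symmetric matrix, so uniqueness applies. *)
Lemma mpinv_tr_sym (R : realType) n (G : 'M[R]_n) :
  G^T = G -> (mpinv G)^T = mpinv G.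
Proof.
move=> sG; have [GBG BGB sGB sBG] := is_mpinv_mpinv G.
apply: mpinv_unique; split.
- by have := congr1 trmx GBG; rewrite !trmx_mul sG mulmxA.
- by have := congr1 trmx BGB; rewrite !trmx_mul sG mulmxA.
- by have := congr1 trmx sBG; rewrite !trmx_mul !trmxK sG.
- by have := congr1 trmx sGB; rewrite !trmx_mul !trmxK sG.
Qed.

Lemma col_proj_tr (R : realType) m p (X : 'M[R]_(m, p)) :
  (col_proj X)^T = col_proj X.
Proof.
rewrite /col_proj !trmx_mul trmxK mulmxA mpinv_tr_sym//.
by rewrite trmx_mul trmxK.
Qed.

Lemma col_proj_idem (R : realType) m p (X : 'M[R]_(m, p)) :
  col_proj X *m col_proj X = col_proj X.
Proof.
have [_ BGB _ _] := is_mpinv_mpinv (X^T *m X).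
by rewrite /col_proj -[in RHS]BGB !mulmxA.
Qed.

Lemma rank_col_proj (R : realType) m p (X : 'M[R]_(m, p)) :
  (\rank (col_proj X) <= \rank X)%N.
Proof. by rewrite /col_proj -mulmxA mxrankM_maxl. Qed.

(** Gram-Schmidt: as long as [Q] differs from [U *m U^T], a nonzero column of the difference is
    orthogonal to the columns of [U] and fixed by [Q], so its normalization extends [U]. The rank of
    [Q] bounds the number of columns. *)
Lemma orthonormal_factor (R : realType) m (Q : 'M[R]_m) :
  Q^T = Q -> Q *m Q = Q ->
  exists k (U : 'M[R]_(m, k)),
    [/\ (k <= \rank Q)%N, U^T *m U = 1%:M & Q = U *m U^T].
Proof.
move=> sQ QQ.
have extend j : exists k (U : 'M[R]_(m, k)),
    [/\ U^T *m U = 1%:M, Q *m U = U & Q = U *m U^T \/ (j <= k)%N].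
  elim: j => [|j [k [U [UU QU QUk]]]].
    exists 0%N, 0; split; [|by rewrite mulmx0|by right].
    by rewrite [LHS]flatmx0 [RHS]flatmx0.
  have [QE|QU'] := pselect (Q = U *m U^T); first by exists k, U; split=> //; left.
  have {QUk} jk : (j <= k)%N by case: QUk.
  pose D := Q - U *m U^T.
  have [i Di0] : exists i, col i D != 0.
    apply: contrapT => Di; apply: QU'; apply/eqP; rewrite -subr_eq0; apply/eqP.
    apply/matrixP => a b; have [/eqP/colP/(_ a)|D0] := boolP (col b D == 0).
      by rewrite !mxE.
    by case: Di; exists b.
  pose c := col i D; pose u := (Num.sqrt (sqnorm c))^-1 *: c.
  have c0 : 0 < sqnorm c.
    rewrite lt_neqAle sqnorm_ge0 andbT eq_sym; apply: contra Di0 => /eqP.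
    by move/sqnorm_eq0 => /eqP.
  have cD : c = D *m delta_mx i 0 by rewrite /c colE.
  have UD : U^T *m D = 0.
    by rewrite mulmxBr mulmxA UU mul1mx -{1}sQ -trmx_mul QU subrr.
  have Uu : U^T *m u = 0 by rewrite -scalemxAr cD mulmxA UD mul0mx scaler0.
  have Qu : Q *m u = u.
    rewrite /u -scalemxAr cD mulmxA; congr (_ *: (_ *m _)).
    by rewrite mulmxBr mulmxA QQ QU.
  have uu : u^T *m u = 1%:M.
    apply/matrixP => a b; rewrite !ord1 -sqnorm_mulmx sqnormZ mxE eqxx.
    by rewrite exprVn sqr_sqrtr ?sqnorm_ge0// mulVf// gt_eqF.
  exists (k + 1)%N, (row_mx U u); split.
  - rewrite tr_row_mx mul_col_row UU Uu uu scalar_mx_block; congr block_mx.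
    by rewrite -[LHS]trmxK trmx_mul trmxK Uu trmx0.
  - by rewrite mul_mx_row QU Qu.
  - by right; rewrite addn1.
(* Asking for one column more than the rank rules out the second alternative of [extend]. *)
have [k [U [UU QU QUk]]] := extend (\rank Q).+1.
have kQ : (k <= \rank Q)%N.
  rewrite -(@mxrank1 R k) -UU (leq_trans (mxrankM_maxr _ _))//.
  by rewrite -{1}QU mxrankM_maxl.
exists k, U; split=> //; case: QUk => // /leq_trans/(_ kQ).
by rewrite ltnn.
Qed.

(** The factor [U] cancels in the Gram matrix. For a unit eigenvector [w] of [A^T *m A], the left
    singular vector [A *m w / s] gives the form the value [s ^+ 2 / s]. *)
Lemma singular_value_bform (R : realType) m k n (U : 'M[R]_(m, k))
    (A : 'M[R]_(k, n)) s :
  U^T *m U = 1%:M -> singular_value (U *m A) s ->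
  exists u v, [/\ sqnorm u <= 1, sqnorm v <= 1 & s = bform A u v].
Proof.
move=> UU [s0 /eigenvalueP[v vs vn0]].
have {vs} vs : v *m (A^T *m A) = s ^+ 2 *: v.
  by rewrite -vs trmx_mul -!mulmxA (mulmxA U^T) UU mul1mx.
set r := sqnorm v^T.
have r0 : 0 < r.
  rewrite lt_neqAle sqnorm_ge0 andbT eq_sym; apply: contra vn0 => /eqP.
  by move/sqnorm_eq0 => /(congr1 trmx); rewrite trmxK trmx0 => ->.
pose w := (Num.sqrt r)^-1 *: v^T.
have w1 : sqnorm w = 1.
  by rewrite sqnormZ exprVn sqr_sqrtr ?(ltW r0)// -/r mulVf// gt_eqF.
have wT : w^T = (Num.sqrt r)^-1 *: v by rewrite linearZ/= trmxK.
have Aw : sqnorm (A *m w) = s ^+ 2.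
  have wA : w^T *m (A^T *m A) = s ^+ 2 *: w^T.
    by rewrite wT -scalemxAl vs !scalerA mulrC.
  rewrite sqnorm_mulmx trmx_mul -mulmxA (mulmxA A^T) mulmxA wA.
  by rewrite -scalemxAl mxE -sqnorm_mulmx w1 mulr1.
(* For [s = 0] the convention [0^-1 = 0] makes the left vector zero, which is still a valid
   witness. *)
exists (s^-1 *: (A *m w)), w; rewrite w1 sqnormZ Aw; split=> //.
  by have [->|sn0] := eqVneq s 0; [rewrite expr0n mulr0|rewrite exprVn mulVf// expf_neq0].
rewrite bform_mulmx [X in X *m A]linearZ -!scalemxAl -mulmxA mxE -sqnorm_mulmx Aw expr2.
by have [->|sn0] := eqVneq s 0; [rewrite !mulr0|rewrite mulKf].
Qed.

Lemma has_ubound_singular_value (R : realType) m n (C : 'M[R]_(m, n)) :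
  has_ubound (singular_value C).
Proof.
exists (\sum_i \sum_j `|C i j|) => s; rewrite -{1}(mul1mx C).
case/singular_value_bform; first by rewrite trmx1 mulmx1.
by move=> u [v [u1 v1 ->]]; exact: bform_le_norm.
Qed.

Lemma d1_ge0 (R : realType) m n (C : 'M[R]_(m, n)) : 0 <= d1 C.
Proof.
have [[s Cs]|C0] := pselect (singular_value C !=set0); last first.
  by rewrite /d1 sup_out// => -[].
case: (Cs) => s0 _; apply: le_trans s0 _; apply: ub_le_sup Cs.
exact: has_ubound_singular_value.
Qed.

Lemma d1_le (R : realType) m k n (U : 'M[R]_(m, k)) (A : 'M[R]_(k, n)) M :
  U^T *m U = 1%:M ->
  (forall y z, sqnorm (lattice_pt R y) <= 1 -> sqnorm (lattice_pt R z) <= 1 ->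
    bform A (lattice_pt R y) (lattice_pt R z) <= M) ->
  d1 (U *m A) <= 2 * M.
Proof.
move=> UU /bform_le leM; have [C0|C0] := pselect (singular_value (U *m A) !=set0).
  apply: ge_sup => // s /(singular_value_bform UU)[u [v [u1 v1 ->]]].
  exact: leM.
(* Without singular values [d1] is the default 0, and [0 <= 2 * M] follows from the form at the zero
   vectors. *)
rewrite /d1 sup_out; last by case.
have s0 l : sqnorm (0 : 'cV[R]_l) = 0.
  by rewrite /sqnorm big1// => i _; rewrite mxE expr0n.
by have := leM 0 0; rewrite !s0 bform_mulmx mulmx0 mxE; apply; exact: ler01.
Qed.

(** This turns the supremum into a root condition on a polynomial, from which measurability can be
    read off. *)
Lemma d1_gt (R : realType) m n (C : 'M[R]_(m, n)) t : 0 <= t ->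
  (t < d1 C) <-> exists2 s, t < s & root (char_poly (C^T *m C)) (s ^+ 2).
Proof.
move=> t0; split=> [tC|[s ts sC]].
  have [C0|C0] := pselect (singular_value C !=set0); last first.
    by move: tC; rewrite /d1 sup_out ?ltNge ?t0//; case.
  have [s [s0 sC] ts] := sup_gt C0 tC.
  by exists s; rewrite // -eigenvalue_root_char.
have Cs : singular_value C s.
  by split; [rewrite (le_trans t0)// ltW|rewrite eigenvalue_root_char].
by apply: lt_le_trans ts _; apply: ub_le_sup Cs; exact: has_ubound_singular_value.
Qed.

(** * Measurability of the largest singular value *)

(** By compactness [|p|] attains its minimum on the interval, and a positive minimum would exceed
    some [1 / (k + 1)]. *)
Lemma poly_root_itvP (R : realType) (p : {poly R}) (a b : R) :
  (forall k, exists2 r, a <= r <= b & `|p.[r]| < k.+1%:R^-1) ->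
  exists2 r, a <= r <= b & root p r.
Proof.
move=> small.
have ab : a <= b by have [r /andP[/le_trans h /h]] := small 0%N.
have [//|c cab minc] := @EVT_min R (fun x => `|p.[x]|) a b ab.
  apply: continuous_subspaceT => x; apply: continuous_comp.
    exact: continuous_horner.
  exact: norm_continuous.
exists c; first by rewrite in_itv/= in cab.
rewrite /root -normr_eq0; apply: contraT => pc0.
have pc : 0 < `|p.[c]| by rewrite lt_neqAle eq_sym pc0 normr_ge0.
have [k _ /(_ k (leqnn k))/= kp] := near_infty_natSinv_lt (PosNum pc).
have [r rab pr] := small k.
have := minc r; rewrite in_itv/= => /(_ rab).
by rewrite leNgt (lt_trans pr).
Qed.

Lemma measurable_root_ge d (T : measurableType d) (R : realType)
    (p : T -> {poly R}) (a : R) :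
  (forall r, measurable_fun setT (fun w => (p w).[r])) ->
  measurable [set w | exists2 r, a <= r & root (p w) r].
Proof.
move=> mp.
(* A root is approximated by points [a + q] with [q] rational just above it,
   so that [0 <= q] holds; the converse uses compactness of [[a, a + N]]. *)
suff -> : [set w | exists2 r, a <= r & root (p w) r] =
  (\bigcup_(N : nat) \bigcap_(k : nat) \bigcup_(q : rat)
  [set w : T | (0 <= (ratr q : R) <= N%:R) && (`|(p w).[a + ratr q]| < k.+1%:R^-1)]).
  apply: bigcup_measurable => N _; apply: bigcap_measurableType => k _.
  apply: bigcupT_measurable_rat => q.
  case: (0 <= (ratr q : R) <= N%:R)=> /=; last first.
    by have -> : [set _ : T | false] = set0 by apply/seteqP; split.
  rewrite -[X in measurable X]setTI.
  have mn : measurable_fun setT (fun w => `|(p w).[a + ratr q]|).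
    exact: measurableT_comp.
  have := measurable_fun_ltr mn (measurable_cst (k.+1%:R^-1 : R)).
  by move=> /(_ measurableT [set true] I).
apply/seteqP; split => [w [r ar pr]|w [N _ Nw]] /=.
  have [N Nr] : exists N, r - a + 1 < N%:R.
    by eexists; exact: truncnS_gt.
  exists N => // k _.
  have /cvgrPdist_lt/(_ k.+1%:R^-1) := @continuous_horner R (p w) r.
  rewrite invr_gt0 ltr0n => /(_ isT); rewrite (rootP pr).
  case/nbhs_ballP => e /= e0 er.
  (* The cap at 1 keeps [q] below [N], which was taken larger than [r - a + 1]. *)
  have : r - a < r - a + Num.min e 1 by rewrite ltrDl lt_min e0/=.
  case/rat_in_itvoo => q; rewrite in_itv/= => /andP[q1 q2].
  exists q => //=; apply/andP; split.
    have m1 : Num.min e 1 <= 1 :> R by rewrite ge_min lexx orbT.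
    by apply/andP; split; lra.
  have me : Num.min e 1 <= e :> R by rewrite ge_min lexx.
  have := er (a + ratr q); rewrite /ball/= sub0r normrN; apply.
  by rewrite distrC ger0_norm; lra.
have [k|r /andP[ar _] pr] := @poly_root_itvP R (p w) a (a + N%:R).
  have [q _ /= /andP[/andP[q0 qN] qk]] := Nw k I.
  by exists (a + ratr q) => //; apply/andP; split; lra.
by exists r.
Qed.

(** Evaluation at [r] commutes with the determinant, and the Leibniz formula then writes the value
    as a polynomial in the entries. *)
Lemma measurable_char_poly d (T : measurableType d) (R : realType) n
    (M : T -> 'M[R]_n) (r : R) :
  (forall i j, measurable_fun setT (fun w => M w i j)) ->
  measurable_fun setT (fun w => (char_poly (M w)).[r]).
Proof.
move=> mM.
have -> : (fun w => (char_poly (M w)).[r]) = fun w =>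
    \sum_(s : 'S_n) (-1) ^+ s * \prod_i (r *+ (i == s i) - M w i (s i)).
  apply/funext => w; rewrite -horner_evalE -det_map_mx.
  apply: eq_bigr => s _; congr (_ * _); apply: eq_bigr => i _.
  rewrite !mxE -[LHS]/(_.[r]).
  by rewrite hornerD hornerN hornerC hornerMn hornerX.
apply: measurable_sum => s; apply: measurable_funM => //.
apply: measurable_prod => i _; apply: measurable_funB => //.
Qed.

Lemma measurable_d1 d (T : measurableType d) (R : realType) m n
    (C : T -> 'M[R]_(m, n)) :
  (forall i j, measurable_fun setT (fun w => C w i j)) ->
  measurable_fun setT (fun w => d1 (C w)).
Proof.
move=> mC; apply: (measurability _ (RGenOInfty.measurableE R)).
move=> /= _ [_ [t ->]] <-; apply: measurableI => //; rewrite preimage_itvoy.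
have [t0|t0] := ltP t 0.
  suff -> : [set w | t < d1 (C w)] = setT by [].
  by apply/seteqP; split => // w _ /=; rewrite (lt_le_trans t0)// d1_ge0.
(* The strict inequality is a countable union of closed ones, to which [measurable_root_ge]
   applies. *)
suff -> : [set w | t < d1 (C w)] = \bigcup_(k : nat) [set w |
    exists2 r, (t + k.+1%:R^-1) ^+ 2 <= r & root (char_poly ((C w)^T *m C w)) r].
  apply: bigcup_measurable => k _; apply: measurable_root_ge => r.
  apply: measurable_char_poly => i j.
  under eq_fun do rewrite mxE.
  apply: measurable_sum => l; apply: measurable_funM => //.
  by under eq_fun do rewrite mxE; exact: mC.
apply/seteqP; split => [w /= /(d1_gt _ t0)[s ts sr]|w [k _ [r tr rr]]] /=.
  have st : 0 < s - t by rewrite subr_gt0.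
  have [k _ /(_ k (leqnn k))/= ks] := near_infty_natSinv_lt (PosNum st).
  exists k => //; exists (s ^+ 2) => //.
  rewrite ler_pXn2r ?nnegrE ?addr_ge0//; last exact: le_trans (ltW ts).
  by rewrite addrC -lerBrDr ltW.
have r0 : 0 <= r by rewrite (le_trans _ tr)// sqr_ge0.
apply/(d1_gt _ t0); exists (Num.sqrt r); last by rewrite sqr_sqrtr.
rewrite (@lt_le_trans _ _ (t + k.+1%:R^-1))// ?ltrDl//.
by rewrite -(@ler_pXn2r _ 2) ?nnegrE ?sqrtr_ge0 ?addr_ge0// sqr_sqrtr.
Qed.

(** * Integrals of products of independent variables *)

Section integral_mul_factor.
Import HBNNSimple.

(** The last hypothesis is the case of an indicator [g]; linearity extends it to simple functions
    and monotone convergence to nonnegative measurable [g]. Finiteness of the integral of [H] lets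
    it pass through the limit. *)
Lemma integral_mul_factor d (T : measurableType d) (R : realType)
    (P : probability T R) (H : T -> R) (W : {RV P >-> R}) (g : R -> R) :
  measurable_fun setT H -> (forall w, 0 <= H w) ->
  (\int[P]_w (H w)%:E < +oo)%E ->
  measurable_fun setT g -> (forall r, 0 <= g r) ->
  (forall B, measurable B ->
    \int[P]_w (H w * \1_(W @^-1` B) w)%:E =
    \int[P]_w (H w)%:E * P (W @^-1` B))%E ->
  (\int[P]_w (H w * g (W w))%:E =
   \int[P]_w (H w)%:E * \int[P]_w (g (W w))%:E)%E.
Proof.
move=> mH H0 Hoo mg g0 HB.
have mW : measurable_fun setT W by exact: measurable_funP.
have mgE : measurable_fun setT (fun r => (g r)%:E) by exact/measurable_EFinP.
pose h := nnsfun_approx measurableT mgE.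
have cH : (\int[P]_w (H w)%:E)%E \is a fin_num.
  by rewrite ge0_fin_numE// integral_ge0// => w _; rewrite lee_fin.
have hcvg r : EFin (h n r) @[n --> \oo] --> (g r)%:E.
  by apply: (cvg_nnsfun_approx measurableT mgE) => // x _; rewrite lee_fin.
have hnd r : {homo (fun n => (h n r)%:E) : a b / (a <= b)%N >-> (a <= b)%E}.
  by move=> a b ab; rewrite lee_fin; exact/lefP/nd_nnsfun_approx.
have mhW n : measurable_fun setT (fun w => h n (W w)).
  by apply: measurableT_comp => //; exact: measurable_funP.
have -> : (\int[P]_w (g (W w))%:E =
    lim (\int[P]_w (h n (W w))%:E @[n --> \oo]))%E.
  rewrite -monotone_convergence//=.
  - by apply: eq_integral => w _; apply/esym/cvg_lim => //; exact: hcvg.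
  - by move=> n; exact/measurable_EFinP.
  - by move=> n w _; rewrite lee_fin. 
have -> : (\int[P]_w (H w * g (W w))%:E =
    lim (\int[P]_w (H w * h n (W w))%:E @[n --> \oo]))%E.
  rewrite -monotone_convergence//=.
  - apply: eq_integral => w _; apply/esym/cvg_lim => //.
    by under eq_fun do rewrite EFinM; rewrite EFinM; apply: cvgeZl.
  - by move=> n; apply/measurable_EFinP; exact: measurable_funM.
  - by move=> n w _; rewrite lee_fin mulr_ge0.
  - by move=> w _ a b ab; rewrite !EFinM lee_wpmul2l ?lee_fin//; exact: hnd.
have step n : (\int[P]_w (H w * h n (W w))%:E =
    \int[P]_w (H w)%:E * \int[P]_w (h n (W w))%:E)%E.
  have e w : h n (W w) = \sum_(y \in range (h n))
      y * \1_(W @^-1` (h n @^-1` [set y])) w.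
    by rewrite fimfunE; apply: eq_fsbigr => y _.
  have mp y : measurable (W @^-1` (h n @^-1` [set y])).
    by rewrite -[X in measurable X]setTI; apply: mW => //; exact: measurable_sfunP.
  (* For negative [y] the preimage is empty, as [h n] is nonnegative. *)
  have y0 y w : 0 <= y * \1_(W @^-1` (h n @^-1` [set y])) w.
    rewrite indicE; have [/set_mem/= <-|_] := boolP (w \in _).
      by rewrite mulr1.
    by rewrite mulr0.
  under eq_integral do rewrite e mulr_fsumr -fsumEFin//.
  rewrite ge0_integral_fsum//; last 2 first.
  - move=> y; apply/measurable_EFinP; apply: measurable_funM => //.
    by apply: measurable_funM => //; exact: measurable_indic.
  - by move=> y w _; rewrite lee_fin mulr_ge0.
  under [X in (_ = _ * X)%E]eq_integral do rewrite e -fsumEFin//.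
  rewrite ge0_integral_fsum//; last 2 first.
  - move=> y; apply/measurable_EFinP.
    by apply: measurable_funM => //; exact: measurable_indic.
  - by move=> y w _; rewrite lee_fin.
  rewrite ge0_mule_fsumr; last first.
    by move=> y; apply: integral_ge0 => w _; rewrite lee_fin.
  apply: eq_fsbigr => y /set_mem[r _ yr].
  have yge0 : 0 <= y by rewrite -yr.
  under eq_integral do rewrite mulrCA EFinM.
  rewrite ge0_integralZl_EFin//; last 2 first.
  - by move=> w _; rewrite lee_fin mulr_ge0.
  - apply/measurable_EFinP; apply: measurable_funM => //.
  under [X in (_ = _ * X)%E]eq_integral do rewrite EFinM.
  rewrite ge0_integralZl_EFin//; last first.
    by apply/measurable_EFinP; exact: measurable_indic.
  rewrite HB// integral_indic// setIT muleCA//.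
under eq_fun do rewrite step.
apply/cvg_lim => //; apply: cvgeZl => //.
apply: ereal_nondecreasing_is_cvgn => a b ab; apply: ge0_le_integral => //.
- by move=> w _; rewrite lee_fin.
- exact/measurable_EFinP.
- exact/measurable_EFinP.
- by move=> w _; exact: hnd.
Qed.

End integral_mul_factor.

Lemma independent_RVs_integral_prod d (T : measurableType d) (R : realType)
    (P : probability T R) (I : finType) (W : I -> {RV P >-> R})
    (g : I -> R -> R) :
  independent_RVs W ->
  (forall i, measurable_fun setT (g i)) -> (forall i r, 0 <= g i r) ->
  (forall i, \int[P]_w (g i (W i w))%:E < +oo)%E ->
  (\int[P]_w (\prod_i g i (W i w))%:E = \prod_i \int[P]_w (g i (W i w))%:E)%E.
Proof.
move=> indW mg g0 goo.
have mW i : measurable_fun setT (W i) by exact: measurable_funP.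
have mgW i : measurable_fun setT (fun w => g i (W i w)).
  exact: measurableT_comp.
have mcap (J : {set I}) (A : I -> set R) :
    (forall i, measurable (A i)) ->
    measurable (\bigcap_(i in [set` J]) (W i @^-1` A i)).
  move=> mA; apply: fin_bigcap_measurable => // i _.
  by rewrite -[X in measurable X]setTI; exact: mW.
(* The induction removes one [g i] from the product at a time; the set [J]
   keeps track of indices carrying an indicator instead, to which
   [integral_mul_factor] reduces [g i]. *)
have key (s : seq I) (J : {set I}) (A : I -> set R) :
    (forall i, measurable (A i)) -> uniq s -> {in s, forall i, i \notin J} ->
    (\int[P]_w ((\prod_(i <- s) g i (W i w)) *
       \1_(\bigcap_(i in [set` J]) (W i @^-1` A i)) w)%:E =
     (\prod_(i <- s) \int[P]_w (g i (W i w))%:E) *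
       P (\bigcap_(i in [set` J]) (W i @^-1` A i)))%E.
  elim: s J A => [|i s IH] J A mA.
    move=> _ _; rewrite big_nil mul1e.
    under eq_integral do rewrite big_nil mul1r.
    by rewrite integral_indic// ?setIT//; exact: mcap.
  move=> /= /andP[nis us] sJ.
  have sJ' : {in s, forall i, i \notin J}.
    by move=> j js; apply: sJ; rewrite inE js orbT.
  have iJ : i \notin J by apply: sJ; rewrite inE eqxx.
  under eq_integral do rewrite big_cons -mulrA mulrC.
  rewrite (@integral_mul_factor _ _ _ _ _ (W i) (g i))//.
  - by rewrite IH// big_cons -!muleA [RHS]muleC -muleA.
  - apply: measurable_funM; last by apply: measurable_indic; exact: mcap.
    exact: measurable_prod.
  - by move=> w; rewrite mulr_ge0// prodr_ge0.
  - rewrite IH//; apply: lte_mul_pinfty.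
    + by apply: prode_ge0 => j _; apply: integral_ge0 => w _; rewrite lee_fin.
    + elim/big_ind : _ => // [x y xf yf|j _]; first exact: fin_numM.
      by rewrite ge0_fin_numE// integral_ge0// => w _; rewrite lee_fin.
    + by rewrite (le_lt_trans (probability_le1 _ _)) ?ltry//; exact: mcap.
  move=> B mB.
  (* The indicator of [W i] in [B] is absorbed by adding [i] to [J]; since [i] was not in [J], the
     old constraints are unchanged. *)
  pose A' j := if j == i then B else A j.
  have mA' j : measurable (A' j) by rewrite /A'; case: ifP.
  have capE : \bigcap_(j in [set` i |: J]) (W j @^-1` A' j) =
      (W i @^-1` B) `&` \bigcap_(j in [set` J]) (W j @^-1` A j).
    apply/seteqP; split => [w /= cw|w /= [wB wA] j /=].
      split; first by have := cw i; rewrite /A' /= !inE eqxx; exact.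
      move=> j /= jJ; have := cw j; rewrite /A' /= !inE jJ orbT.
      by case: eqP jJ iJ => [-> -> //|_ _ _]; exact.
    rewrite !inE /A'; case: eqP => [-> //|_ /= jJ]; exact: wA.
  transitivity (\int[P]_w ((\prod_(i <- s) g i (W i w)) *
       \1_(\bigcap_(j in [set` i |: J]) (W j @^-1` A' j)) w)%:E)%E.
    apply: eq_integral => w _; rewrite capE indicI/= -mulrA; congr (_ * _)%:E.
    by rewrite mulrC.
  rewrite IH//; last first.
    move=> j js; rewrite !inE negb_or sJ'// andbT.
    by apply: contra nis => /eqP <-.
  rewrite IH// -muleA; congr (_ * _)%E.
  rewrite !indW//= big_setU1//= /A' eqxx muleC; congr (_ * _)%E.
  by apply: eq_bigr => j jJ; case: eqP jJ iJ => // -> ->.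
have := key (index_enum I) finset.set0 (fun=> setT) (fun=> measurableT)
  (index_enum_uniq I).
have -> : \bigcap_(i in [set` @finset.set0 I]) (W i @^-1` setT) = setT.
  by apply/seteqP; split => // w _ i /=.
rewrite probability_setT mule1 => <-; last by move=> i; rewrite inE.
by apply: eq_integral => w _; rewrite indicT mulr1.
Qed.

(** * The moment generating function of the largest singular value *)

Lemma le_prode (R : realType) (I : Type) (s : seq I) (f g : I -> \bar R) :
  (forall i, 0 <= f i)%E -> (forall i, f i <= g i)%E ->
  (\prod_(i <- s) f i <= \prod_(i <- s) g i)%E.
Proof.
move=> f0 fg; elim: s => [|i s IH]; first by rewrite !big_nil.
by rewrite !big_cons lee_pmul// prode_ge0.
Qed.

(** By independence the subGaussian moments add up, and the squared coefficients [l * u_i * v_j] sum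
    to [l ^+ 2 * sqnorm u * sqnorm v]. *)
Lemma mgf_bform_le d (T : measurableType d) (R : realType) (P : probability T R)
    (m n : nat) (E : 'I_m * 'I_n -> {RV P >-> R}) (Gamma : R) u v (l : R) :
  0 < Gamma -> independent_RVs E -> (forall ij, subGaussian (E ij) Gamma) ->
  sqnorm u <= 1 -> sqnorm v <= 1 ->
  (\int[P]_w (expR (l * bform (random_mx E w) u v))%:E
   <= (expR (Gamma * l ^+ 2 / 2))%:E)%E.
Proof.
move=> G0 indE subE u1 v1.
pose c (ij : 'I_m * 'I_n) := l * (u ij.1 0 * v ij.2 0).
have mgfE ij : (\int[P]_w (expR (E ij w * c ij))%:E
    <= (expR (Gamma * c ij ^+ 2 / 2))%:E)%E.
  by have [_ /(_ (c ij))] := subE ij; rewrite /mmt_gen_fun unlock.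
have bE w : expR (l * bform (random_mx E w) u v) = \prod_ij expR (E ij w * c ij).
  rewrite -expR_sum; congr expR; rewrite /bform pair_bigA/= mulr_sumr.
  by apply: eq_bigr => -[i j] _; rewrite mxE /c/=; ring.
under eq_integral do rewrite bE.
have int_ge0 ij : (0 <= \int[P]_w (expR (E ij w * c ij))%:E)%E.
  by apply: integral_ge0 => w _; rewrite lee_fin expR_ge0.
rewrite (@independent_RVs_integral_prod _ _ _ _ _ E
  (fun ij x => expR (x * c ij)))//; last 2 first.
- by move=> ij; apply: measurableT_comp => //; exact: mulrr_measurable.
- by move=> ij; rewrite (le_lt_trans (mgfE ij))// ltry.
rewrite (le_trans (le_prode _ int_ge0 mgfE))// prodEFin -expR_sum lee_fin ler_expR.
rewrite -mulr_suml -mulr_sumr ler_pM2r// ler_pM2l//.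
have -> : \sum_ij c ij ^+ 2 = l ^+ 2 * (sqnorm u * sqnorm v).
  rewrite /sqnorm mulr_suml; under [in RHS]eq_bigr do rewrite mulr_sumr.
  rewrite pair_bigA mulr_sumr/=; apply: eq_bigr => -[i j] _.
  by rewrite /c/= !exprMn.
by rewrite ler_piMr ?sqr_ge0// mulr_ile1// sqnorm_ge0.
Qed.

(** A union bound in exponential form: each summand is at most the sum [Z], so [d1_le] applies with
    [M = ln Z / l]. *)
Lemma expR_d1_le (R : realType) m k n (U : 'M[R]_(m, k)) (A : 'M[R]_(k, n)) l :
  U^T *m U = 1%:M -> 0 < l ->
  expR (l * (d1 (U *m A) / 2)) <=
    \sum_(yz | (sqnorm (lattice_pt R yz.1) <= 1) && (sqnorm (lattice_pt R yz.2) <= 1))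
      expR (l * bform A (lattice_pt R yz.1) (lattice_pt R yz.2)).
Proof.
move=> UU l0; set Z := \sum_(_ | _) _.
have leZ y z : sqnorm (lattice_pt R y) <= 1 -> sqnorm (lattice_pt R z) <= 1 ->
    expR (l * bform A (lattice_pt R y) (lattice_pt R z)) <= Z.
  move=> y1 z1; rewrite /Z (bigD1 (y, z))/= ?y1 ?z1// lerDl.
  by apply: sumr_ge0 => x _; exact: expR_ge0.
have Z0 : 0 < Z.
  have s0 j : sqnorm (0 : 'cV[R]_j) <= 1.
    by rewrite /sqnorm big1// => i _; rewrite mxE expr0n.
  have [y [y1 _]] := lattice_pt_approx (s0 k).
  have [z [z1 _]] := lattice_pt_approx (s0 n).
  exact: lt_le_trans (expR_gt0 _) (leZ _ _ y1 z1).
rewrite -[leRHS](@lnK _ Z) ?posrE// ler_expR -ler_pdivlMl// ler_pdivrMr// mulrC.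
apply: d1_le UU _ => y z y1 z1; rewrite ler_pdivlMl//.
by rewrite -ler_expR lnK ?posrE//; exact: leZ.
Qed.

Lemma mgf_d1_le d (T : measurableType d) (R : realType) (P : probability T R)
    (m n p : nat) (E : 'I_m * 'I_n -> {RV P >-> R}) (Gamma : R)
    (X : 'M[R]_(m, p)) (l : R) :
  0 < Gamma -> independent_RVs E -> (forall ij, subGaussian (E ij) Gamma) ->
  0 < l ->
  (\int[P]_w (expR (l * (d1 (col_proj X *m random_mx E w) / 2)))%:E
   <= (64 ^+ (n + \rank X) * expR (Gamma * l ^+ 2 / 2))%:E)%E.
Proof.
move=> G0 indE subE l0.
have [k [U [kX UU ->]]] := orthonormal_factor (col_proj_tr X) (col_proj_idem X).
have {}kX := leq_trans kX (rank_col_proj X).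
have mE i j : measurable_fun setT (fun w => random_mx E w i j).
  by under eq_fun do rewrite mxE; exact: measurable_funP.
have mmul a b c (B : T -> 'M[R]_(b, c)) (D : 'M[R]_(a, b)) :
    (forall i j, measurable_fun setT (fun w => B w i j)) ->
    (forall i j, measurable_fun setT (fun w => (D *m B w) i j)).
  move=> mB i j; under eq_fun do rewrite mxE.
  by apply: measurable_sum => h; apply: measurable_funM.
have mUE := mmul _ _ _ _ U^T mE.
have mb u v : measurable_fun setT (fun w => bform (U^T *m random_mx E w) u v).
  apply: measurable_sum => i; apply: measurable_sum => j.
  by apply: measurable_funM => //; apply: measurable_funM.
pose Q (yz : {ffun 'I_k -> bool * 'I_(4 * k).+1} *
             {ffun 'I_n -> bool * 'I_(4 * n).+1}) :=
  (sqnorm (lattice_pt R yz.1) <= 1) && (sqnorm (lattice_pt R yz.2) <= 1).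
pose F yz w := expR (l * bform (U^T *m random_mx E w) (lattice_pt R yz.1)
  (lattice_pt R yz.2)).
have mF yz : measurable_fun setT (F yz).
  apply: measurableT_comp => //; exact: measurable_funM.
apply: (@le_trans _ _ (\int[P]_w (\sum_(yz <- enum Q) (F yz w)%:E))%E).
  apply: ge0_le_integral => //.
  - apply/measurable_EFinP; apply: measurableT_comp => //.
    apply: measurable_funM => //; apply: measurable_funM => //.
    exact: measurable_d1 (mmul _ _ _ _ (U *m U^T) mE).
  - by apply: emeasurable_sum => yz; exact/measurable_EFinP.
  - move=> w _; rewrite sumEFin lee_fin big_enum/= -mulmxA.
    exact: expR_d1_le.
rewrite ge0_integral_sum//; last 2 first.
- by move=> yz; exact/measurable_EFinP.
- by move=> yz w _; rewrite lee_fin expR_ge0.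
apply: (@le_trans _ _ (\sum_(yz <- enum Q) (expR (Gamma * l ^+ 2 / 2))%:E)%E).
  rewrite !big_enum/=; apply: lee_sum => yz /andP[y1 z1].
  (* The entries of [U^T *m E] need not be independent, so [U] is moved onto the lattice point,
     whose norm it preserves. *)
  have bE w : bform (U^T *m random_mx E w) (lattice_pt R yz.1) (lattice_pt R yz.2) =
      bform (random_mx E w) (U *m lattice_pt R yz.1) (lattice_pt R yz.2).
    by rewrite !bform_mulmx trmx_mul !mulmxA.
  under eq_integral do rewrite /F bE.
  apply: mgf_bform_le => //.
  by rewrite sqnorm_mulmx trmx_mul -mulmxA (mulmxA U^T) UU mul1mx -sqnorm_mulmx.
rewrite sumEFin lee_fin -[in leLHS](mul1r (expR _)) -mulr_suml ler_wpM2r ?expR_ge0//.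
rewrite big_enum/= -(pair_big (fun y => sqnorm (lattice_pt R y) <= 1)
  (fun z => sqnorm (lattice_pt R z) <= 1) (fun _ _ => 1))/=.
apply: (@le_trans _ _ (64 ^+ k * 64 ^+ n)).
  apply: (@le_trans _ _ (\sum_(y : {ffun 'I_k -> _}
      | sqnorm (lattice_pt R y) <= 1) 1 * 64 ^+ n)).
    by apply: ler_sum => y _; rewrite mul1r card_lattice_ball.
  by rewrite -mulr_suml ler_wpM2r ?exprn_ge0// card_lattice_ball.
by rewrite -exprD addnC ler_weXn2l ?ler1n// leq_add2l.
Qed.

(** Covers the degenerate case [n + q = 0] of the expectation bound. *)
Lemma d1_cols0 (R : realType) m (C : 'M[R]_(m, 0)) : d1 C = 0.
Proof.
apply/eqP; rewrite eq_le d1_ge0 andbT -{1}(mul1mx C) -(mulr0 2).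
apply: d1_le => [|y z _ _]; first by rewrite trmx1 mulmx1.
by rewrite /bform big1// => i _; rewrite big_ord0.
Qed.

Theorem proposition15 (d : measure_display) (T : measurableType d)
    (R : realType) (P : probability T R) (m n p q : nat)
    (E : 'I_m * 'I_n -> {RV P >-> R}) (GammaE : R) (X : 'M[R]_(m, p))
    (GammaE_gt0 : 0 < GammaE)
    (E_indep : independent_RVs E)
    (E_subGaussian : forall ij, subGaussian (E ij) GammaE)
    (rankX : \rank X = q) :
  (forall x : R, 0 < x ->
    (P [set w | (32 * GammaE * ((n + q)%:R * ln 5 + x)
                 <= d1 (col_proj X *m random_mx E w) ^+ 2)%R]
     <= (2 * expR (- x))%:E)%E) /\
  ('E_P[fun w => d1 (col_proj X *m random_mx E w)%R]
   <= (15 * Num.sqrt GammaE * Num.sqrt (n + q)%:R)%:E)%E.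
Proof.
subst q; set D := fun w => d1 (col_proj X *m random_mx E w).
set N := (n + \rank X)%N.
have D0 w : 0 <= D w by exact: d1_ge0.
have mD : measurable_fun setT D.
  apply: measurable_d1 => i j; under eq_fun do rewrite mxE.
  apply: measurable_sum => h; apply: measurable_funM => //.
  by under eq_fun do rewrite mxE; exact: measurable_funP.
have mexpD l : measurable_fun setT (fun w => expR (l * (D w / 2))).
  by apply: measurableT_comp => //; apply: measurable_funM => //; exact: measurable_funM.
have mgfD l : 0 < l -> (\int[P]_w (expR (l * (D w / 2)))%:E
    <= (64 ^+ N * expR (GammaE * l ^+ 2 / 2))%:E)%E.
  exact: mgf_d1_le.
split.
  move=> x x0; set b := N%:R * ln 5 + x; set S := [set w | _].
  have ln5 : 0 < ln 5 :> R by rewrite ln_gt0// ltr1n.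
  have b0 : 0 < b by rewrite ltr_wpDl// mulr_ge0// ltW.
  pose s := Num.sqrt (32 * GammaE * b).
  have s2 : s ^+ 2 = 32 * GammaE * b by rewrite sqr_sqrtr// !mulr_ge0// ltW.
  have s0 : 0 < s by rewrite sqrtr_gt0 !mulr_gt0.
  (* This [l] minimizes the Chernoff exponent [GammaE * l ^+ 2 / 2 - l * s / 2]. *)
  pose l := s / (2 * GammaE).
  have l0 : 0 < l by rewrite divr_gt0// mulr_gt0.
  have SE : S = D @^-1` `[s, +oo[.
    apply/seteqP; split => w; rewrite /S/= in_itv/= andbT -s2;
      by rewrite -/(D w) ler_pXn2r ?nnegrE ?(ltW s0)//.
  have mS : measurable S by rewrite SE -[X in measurable X]setTI; exact: mD.
  have ls : l * (s / 2) = 8 * b.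
    rewrite /l (_ : _ * _ = s ^+ 2 / (4 * GammaE)); last by field; rewrite gt_eqF.
    by rewrite s2; field; rewrite gt_eqF.
  have lG : GammaE * l ^+ 2 / 2 = 4 * b.
    rewrite /l (_ : _ / 2 = s ^+ 2 / (8 * GammaE)); last by field; rewrite gt_eqF.
    by rewrite s2; field; rewrite gt_eqF.
  have chernoff : ((expR (8 * b))%:E * P S <= (64 ^+ N * expR (4 * b))%:E)%E.
    have -> : P S = (\int[P]_w (\1_S w)%:E)%E by rewrite integral_indic// setIT.
    rewrite -lG -ge0_integralZl_EFin ?expR_ge0//.
      apply: le_trans (mgfD l l0); apply: ge0_le_integral => //.
      - by apply/measurable_EFinP; apply: measurable_funM => //; exact: measurable_indic.
      - exact/measurable_EFinP.
      - move=> w _; rewrite -EFinM lee_fin indicE.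
        have [/set_mem wS|_] := boolP (w \in S); last by rewrite mulr0 expR_ge0.
        rewrite mulr1 ler_expR -ls ler_pM2l// ler_pM2r//.
        by move: wS; rewrite SE/= in_itv/= andbT.
    by apply/measurable_EFinP; exact: measurable_indic.
  rewrite -lee_pdivlMl ?expR_gt0// in chernoff.
  apply: le_trans chernoff _; rewrite -EFinM lee_fin ler_pdivrMl ?expR_gt0//.
  have p64 : 64 ^+ N <= expR (4 * (N%:R * ln 5)) :> R.
    rewrite mulrCA expRM_natl expRM_natl lnK ?posrE//.
    rewrite lerXn2r ?nnegrE ?exprn_ge0//.
    by rewrite -natrX ler_nat.
  apply: (@le_trans _ _ (expR (4 * (N%:R * ln 5)) * expR (4 * b))).
    by rewrite ler_wpM2r ?expR_ge0.
  (* The exponent on the left is [4 * (b - x) + 4 * b = 8 * b - 4 * x]. *)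
  rewrite [leRHS]mulrCA -!expRD; apply: (@le_trans _ _ (expR (8 * b - x))).
    by rewrite ler_expR /b; lra.
  by rewrite ler_peMl ?expR_ge0// ler1n.
rewrite unlock.
have [N0|Npos] := posnP N.
  have n0 : n = 0%N by apply/eqP; move/eqP: N0; rewrite addn_eq0 => /andP[].
  have DE w : D w = 0 by subst n; exact: d1_cols0.
  under eq_integral do rewrite DE.
  by rewrite integral0 lee_fin !mulr_ge0// sqrtr_ge0.
have rN0 : 0 < (N%:R : R) by rewrite ltr0n.
set g := Num.sqrt GammaE; set r := Num.sqrt _.
have g0 : 0 < g by rewrite sqrtr_gt0.
have r0 : 0 < r by rewrite sqrtr_gt0.
have g2 : GammaE = g ^+ 2 by rewrite sqr_sqrtr// ltW.
have r2 : N%:R = r ^+ 2 by rewrite sqr_sqrtr// ltW.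
(* The bound will be [2 * L / l], that is [12 * r ^+ 2 / l + g ^+ 2 * l]; this [l] is close to its
   minimizer [sqrt 12 * r / g] and gives [7 * g * r]. *)
pose l := 4 * r / g.
have l0 : 0 < l by rewrite divr_gt0// mulr_gt0.
pose L := 6 * N%:R + GammaE * l ^+ 2 / 2.
have LE : L = 14 * r ^+ 2.
  by rewrite /L g2 r2 /l; field; rewrite gt_eqF.
have L1 : 0 <= L - 1.
  have : 1 <= N%:R :> R by rewrite ler1n.
  by rewrite LE -r2; lra.
(* Here [64 = 2 ^ 6] and [2 <= expR 1]. *)
have p64 : 64 ^+ N <= expR (6 * N%:R) :> R.
  rewrite mulrC expRM_natl lerXn2r ?nnegrE ?expR_ge0//.
  rewrite -[X in expR X]mulr1 expRM_natl.
  apply: (@le_trans _ _ (2 ^+ 6)); first by rewrite -natrX.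
  by rewrite lerXn2r ?nnegrE ?expR_ge0// (le_trans _ (expR_ge1Dx _))//.
(* The tangent line of [expR] at [L] gives [y <= L - 1 + expR (y - L)]. *)
have Dle w : D w <= 2 / l * (L - 1) + 2 / l * expR (- L) * expR (l * (D w / 2)).
  have := expR_ge1Dx (l * (D w / 2) - L); rewrite expRD => tangent.
  have DE : D w = 2 / l * (l * (D w / 2)) by field; rewrite gt_eqF.
  by rewrite [leLHS]DE -(mulrA (2 / l)) -mulrDr ler_pM2l ?divr_gt0//; lra.
have c0 : 0 <= 2 / l * (L - 1) by rewrite mulr_ge0// divr_ge0// ltW.
have e0 : 0 <= 2 / l * expR (- L) by rewrite mulr_ge0 ?expR_ge0// divr_ge0// ltW.
apply: (@le_trans _ _ (\int[P]_w ((2 / l * (L - 1))%:E +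
    (2 / l * expR (- L))%:E * (expR (l * (D w / 2)))%:E))%E).
  apply: ge0_le_integral => //.
  - by move=> w _; rewrite lee_fin.
  - exact/measurable_EFinP.
  - apply: emeasurable_funD => //; apply: emeasurable_funM => //.
    exact/measurable_EFinP.
  - by move=> w _; rewrite -EFinM -EFinD lee_fin; exact: Dle.
rewrite ge0_integralD//; last 2 first.
- by move=> w _; rewrite mule_ge0// lee_fin ?expR_ge0.
- by apply: emeasurable_funM => //; exact/measurable_EFinP.
rewrite integral_cst// [X in (_ * X)%E](@probability_setT _ _ _ P) mule1.
rewrite ge0_integralZl_EFin//; last exact/measurable_EFinP.
apply: (@le_trans _ _ ((2 / l * (L - 1))%:E + (2 / l * expR (- L))%:E *
    (64 ^+ N * expR (GammaE * l ^+ 2 / 2))%:E)%E).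
  by rewrite leeD2l// lee_wpmul2l ?lee_fin//; exact: mgfD.
rewrite -EFinM -EFinD lee_fin.
(* The point of tangency [L] bounds the logarithm of the moment bound, so the exponential term
   contributes at most 1 and cancels the [- 1]. *)
have : expR (- L) * (64 ^+ N * expR (GammaE * l ^+ 2 / 2)) <= 1.
  rewrite expRN ler_pdivrMl ?expR_gt0// mulr1 /L expRD.
  by rewrite ler_wpM2r ?expR_ge0.
rewrite -(mulrA (2 / l)) -mulrDr => le1.
apply: (@le_trans _ _ (2 / l * L)).
  by rewrite ler_pM2l ?divr_gt0//; lra.
have -> : 2 / l * L = 7 * g * r.
  by rewrite LE /l; field; rewrite !gt_eqF.
by rewrite !ler_pM2r// ler_nat.
Qed.
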